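(* Let $m,n\ge1$ and let $\Phi^1\le\Gamma^1$, $\Phi^2\le\Gamma^2$ be integer-valued $m\times n$ matrices (entries of $\Phi^1,\Phi^2$ may be $-\infty$, entries of $\Gamma^1,\Gamma^2$ may be $+\infty$). Assume that the last column of $\Phi^1$ equals the last column of $\Gamma^1$, the last row of $\Phi^2$ equals the last row of $\Gamma^2$, and the sum of the entries of the last column of $\Phi^1$ equals the sum of the entries of the last row of $\Phi^2$; let $H$ be this common value. Let $f\le g$ be integer-valued functions on $S_{m,n}$ ($f$ may take $-\infty$, $g$ may take $+\infty$). Then there exists a prefix-bounded matrix $x$ with $f\le x\le g$ if and only if $$H\le b^*_1(X')+b^*_2(X'')+\tilde g(\overline{X'}\cap\overline{X''})-\tilde f(X'\cap X'')$$ holds for every $X',X''\subseteq S_{m,n}$.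
   Context: $S_{m,n}=[m]\times[n]$; matrices are functions on $S_{m,n}$; $\tilde h(Z)=\sum_{s\in Z}h(s)$ and $\overline Z=S_{m,n}-Z$. $P^1_{i,j}=\{(i,1),\dots,(i,j)\}$, $P^2_{i,j}=\{(1,j),\dots,(i,j)\}$. A prefix-bounded matrix is an integer-valued $m\times n$ matrix $x$ with $\Phi^1(i,j)\le\tilde x(P^1_{i,j})\le\Gamma^1(i,j)$ and $\Phi^2(i,j)\le\tilde x(P^2_{i,j})\le\Gamma^2(i,j)$ for all $(i,j)$. A horizontal segment is $\{(i,j_1),\dots,(i,j_2)\}$ with $j_1\le j_2$; a vertical segment is $\{(i_1,j),\dots,(i_2,j)\}$ with $i_1\le i_2$. For $X\subseteq S_{m,n}$, $\mathcal I^{ho}(X)$ and $\mathcal I^{ve}(X)$ are the sets of maximal horizontal and vertical segments contained in $X$. With $\Phi^1(i,0)=\Phi^2(0,j)=0$, define $b^*_1(X)=\sum[\Gamma^1(i,j_2)-\Phi^1(i,j_1-1):\{(i,j_1),\dots,(i,j_2)\}\in\mathcal I^{ho}(X)]$ and $b^*_2(X)=\sum[\Gamma^2(i_2,j)-\Phi^2(i_1-1,j):\{(i_1,j),\dots,(i_2,j)\}\in\mathcal I^{ve}(X)]$ (empty sum $0$). Arithmetic is in the extended integers with the usual conventions. *)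

(* Defs.v *)
From mathcomp Require Import all_boot all_order all_algebra.
From mathcomp Require Import constructive_ereal.

Set Implicit Arguments.
Unset Strict Implicit.
Unset Printing Implicit Defensive.

Import Order.TTheory GRing.Theory Num.Theory.

(* The cell (i, j) of [m] x [n] is encoded with indices shifted to start at 0;
   the extended integers are [\bar int]. *)

Section PrefixBounded.
Context {m n : nat}.
Implicit Types (i : 'I_m) (j : 'I_n) (X Z : {set 'I_m * 'I_n}).
Implicit Types (h Phi Gamma : 'M[\bar int]_(m, n)) (x : 'M[int]_(m, n)).

Definition tilde h Z : \bar int := (\sum_(s in Z) h s.1 s.2)%E.

Definition prefix1 i j : {set 'I_m * 'I_n} :=
  [set s : 'I_m * 'I_n | (s.1 == i) && (s.2 <= j)%N].

Definition prefix2 i j : {set 'I_m * 'I_n} :=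
  [set s : 'I_m * 'I_n | (s.1 <= i)%N && (s.2 == j)].

Definition prefix_bounded Phi1 Gamma1 Phi2 Gamma2 x : Prop :=
  forall i j,
    (Phi1 i j <= (\sum_(s in prefix1 i j) x s.1 s.2)%R%:E <= Gamma1 i j)%E /\
    (Phi2 i j <= (\sum_(s in prefix2 i j) x s.1 s.2)%R%:E <= Gamma2 i j)%E.

Definition hseg i (j1 j2 : 'I_n) : {set 'I_m * 'I_n} :=
  [set s : 'I_m * 'I_n | (s.1 == i) && (j1 <= s.2 <= j2)%N].

Definition vseg (i1 i2 : 'I_m) j : {set 'I_m * 'I_n} :=
  [set s : 'I_m * 'I_n | (i1 <= s.1 <= i2)%N && (s.2 == j)].

Definition is_hseg Z : bool :=
  [exists i : 'I_m, exists j1 : 'I_n, exists j2 : 'I_n,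
    (j1 <= j2)%N && (Z == hseg i j1 j2)].

Definition is_vseg Z : bool :=
  [exists i1 : 'I_m, exists i2 : 'I_m, exists j : 'I_n,
    (i1 <= i2)%N && (Z == vseg i1 i2 j)].

Definition Iho X : {set {set 'I_m * 'I_n}} :=
  [set Z | maxset (fun Y : {set _} => is_hseg Y && (Y \subset X)) Z].

Definition Ive X : {set {set 'I_m * 'I_n}} :=
  [set Z | maxset (fun Y : {set _} => is_vseg Y && (Y \subset X)) Z].

(* Phi(i, j - 1), with the convention Phi(i, 0) = 0 in 1-based indexing.
   [ord_pred] is cyclic, but it is only used here at nonzero indices. *)
Definition before1 Phi i j : \bar int :=
  if j == 0%N :> nat then 0%E else Phi i (ord_pred j).

(* Phi(i - 1, j), with the convention Phi(0, j) = 0 in 1-based indexing. *)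
Definition before2 Phi i j : \bar int :=
  if i == 0%N :> nat then 0%E else Phi (ord_pred i) j.

(* A horizontal segment has unique parameters i, j1 <= j2, so the sum over
   [Iho X] is indexed by these parameters; similarly for vertical segments. *)
Definition bstar1 Phi1 Gamma1 X : \bar int :=
  (\sum_(i < m) \sum_(j1 < n)
     \sum_(j2 < n | (j1 <= j2)%N && (hseg i j1 j2 \in Iho X))
       (Gamma1 i j2 - before1 Phi1 i j1))%E.

Definition bstar2 Phi2 Gamma2 X : \bar int :=
  (\sum_(j < n) \sum_(i1 < m)
     \sum_(i2 < m | (i1 <= i2)%N && (vseg i1 i2 j \in Ive X))
       (Gamma2 i2 j - before2 Phi2 i1 j))%E.

End PrefixBounded.

(* Main.v *)
Require Import Defs.
From mathcomp Require Import all_boot all_order all_algebra.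
From mathcomp Require Import constructive_ereal zify.

Set Implicit Arguments.
Unset Strict Implicit.
Unset Printing Implicit Defensive.

Import Order.TTheory GRing.Theory Num.Theory.

(** Put a row vertex and a column vertex in every cell, and read the entries of
    [x] together with its row and column prefix sums as a flow: conservation at
    the two vertices of a cell is the recursion of the two prefix sums.  The
    prefix bounds and [f], [g] become capacities, so Hoffman's theorem, proved
    by augmenting paths (which also gives integrality), characterises existence
    by a cut condition.  A vertex set consists of the row vertices of [X'] and
    the column vertices outside [X''], and its cut is the right-hand side of the
    inequality: the prefix arcs leaving and entering are the ends of the maximal
    segments of [X'] and [X''].  Closing every row and column cyclically lets the
    prescribed full sums appear as supplies, which produce [H]. *)

(** * Integral flows with prescribed supplies *)

Section Feasibility.
Local Open Scope ring_scope.
Variables (V E : finType) (src tgt : E -> V).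
Variables (l u : E -> \bar int).

Definition net (x : E -> int) (v : V) : int :=
  \sum_(e | src e == v) x e - \sum_(e | tgt e == v) x e.

Definition feasible (x : E -> int) : Prop :=
  forall e, (l e <= (x e)%:E <= u e)%E.

Definition cut (U : {set V}) : \bar int :=
  (\sum_(e | (src e \in U) && (tgt e \notin U)) u e
   + \sum_(e | (src e \notin U) && (tgt e \in U)) - l e)%E.

Definition residual (x : E -> int) : rel V := fun a b =>
  [exists e, [&& src e == a, tgt e == b & ((x e)%:E < u e)%E]
          || [&& src e == b, tgt e == a & (l e < (x e)%:E)%E]].

Lemma eq_net (x y : E -> int) : x =1 y -> net x =1 net y.
Proof. by move=> xy v; rewrite /net; congr (_ - _); apply: eq_bigr. Qed.

(** An arc with both ends in [U] is counted once with each sign and cancels. *)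
Lemma sum_net (x : E -> int) (U : {set V}) :
  \sum_(v in U) net x v =
  \sum_(e | (src e \in U) && (tgt e \notin U)) x e
  - \sum_(e | (src e \notin U) && (tgt e \in U)) x e.
Proof.
have agg (h : E -> V) :
    \sum_(v in U) \sum_(e | h e == v) x e = \sum_(e | h e \in U) x e.
  rewrite (partition_big h (mem U)) //=; apply: eq_bigr => v vU.
  by apply: eq_bigl => e; case: eqP => [->|]; rewrite ?vU // andbF.
rewrite /net sumrB !agg (bigID (fun e => tgt e \in U)) /=.
rewrite [X in _ - X](bigID (fun e => src e \in U)) /=.
rewrite opprD addrACA.
rewrite -[RHS]add0r; congr (_ + _).
  by apply/eqP; rewrite subr_eq0; apply/eqP/eq_bigl => e; rewrite andbC.
by congr (_ - _); apply: eq_bigl => e; rewrite andbC.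
Qed.

Lemma sum_net_all (x : E -> int) : \sum_v net x v = 0.
Proof.
transitivity (\sum_(v in [set: V]) net x v); first by apply: eq_bigl => v; rewrite inE.
by rewrite sum_net !big_pred0 ?subr0 // => e; rewrite !inE ?andbF.
Qed.

Lemma net_shift (x : E -> int) (e0 : E) (c : int) (v : V) :
  net (fun e => x e + c *+ (e == e0)) v =
  net x v + c *+ (src e0 == v) - c *+ (tgt e0 == v).
Proof.
have agg (h : E -> V) :
    \sum_(e | h e == v) (x e + c *+ (e == e0)) =
    \sum_(e | h e == v) x e + c *+ (h e0 == v).
  rewrite big_split /=; congr (_ + _).
  under eq_bigr => e _ do rewrite mulrb; rewrite -big_mkcondr /=.
  case: eqP => hv.
    by rewrite (big_pred1 e0) // => e /=; case: (e =P e0) => [->|]; rewrite ?hv ?eqxx ?andbF.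
  by rewrite big_pred0 // => e /=; case: (e =P e0) => [->|]; rewrite ?andbF //; case: eqP.
by rewrite /net !agg opprD addrACA -!addrA; congr (_ + _); rewrite addrCA.
Qed.

(** Integrality turns slack into room for a whole unit. The last clause serves the induction along a
    path: only one arc changes, and [a] is one of its ends. *)
Lemma push_edge (x : E -> int) (a b : V) :
  feasible x -> residual x a b -> a != b ->
  exists x', [/\ feasible x',
    forall v, net x' v = net x v + (v == a)%:R - (v == b)%:R &
    forall c d, c != a -> d != a -> residual x c d -> residual x' c d].
Proof.
move=> fx /existsP[e /orP[] /and3P[/eqP se /eqP te lt]] ab.
- exists (fun e' => x e' + 1 *+ (e' == e)); split.
  + move=> e'; case: eqP => [->|_]; last by rewrite addr0.
    have := fx e; move: lt; case: (u e) (l e) => [r| |] [s| |] //=;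
      rewrite ?lte_fin ?lee_fin ?leey ?leNye ?leeNy_eq ?andbF ?andbT ?mulr1n //=; lia.
  + by move=> v; rewrite net_shift se te !(eq_sym v).
  + move=> c d ca da /existsP[e' He']; apply/existsP; exists e'.
    case: (e' =P e) => [ee|_]; last by rewrite addr0.
    by move: He'; rewrite ee se te !(eq_sym a) (negbTE ca) (negbTE da).
- exists (fun e' => x e' + (-1) *+ (e' == e)); split.
  + move=> e'; case: eqP => [->|_]; last by rewrite addr0.
    have := fx e; move: lt; case: (u e) (l e) => [r| |] [s| |] //=;
      rewrite ?lte_fin ?lee_fin ?leey ?leNye ?leeNy_eq ?andbF ?andbT ?mulr1n //=; lia.
  + move=> v; rewrite net_shift se te !(eq_sym v) !mulNrn opprK.
    by rewrite addrAC.
  + move=> c d ca da /existsP[e' He']; apply/existsP; exists e'.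
    case: (e' =P e) => [ee|_]; last by rewrite addr0.
    by move: He'; rewrite ee se te !(eq_sym a) (negbTE ca) (negbTE da) !andbF.
Qed.

(* On a duplicate-free path, pushing along the first edge leaves the residual
   capacities of the rest of the path unchanged. *)
Lemma push_path (p : seq V) (x : E -> int) (a : V) :
  feasible x -> path (residual x) a p -> uniq (a :: p) ->
  exists2 x', feasible x' &
    forall v, net x' v = net x v + (v == a)%:R - (v == last a p)%:R.
Proof.
elim: p a x => [|b p IH] a x fx /=.
  by move=> _ _; exists x => // v; rewrite addrK.
case/andP=> rab pb /andP[]; rewrite inE negb_or => /andP[ab ap] ubp.
have [x1 [fx1 net1 res1]] := push_edge fx rab ab.
have pb1 : path (residual x1) b p.
  apply: (sub_in_path (P := [pred v | v != a])) pb => [c d ca da|].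
    exact: res1.
  rewrite /= eq_sym ab /=; apply/allP => v vp /=.
  by apply: contraNneq ap => <-.
have [x' fx' net'] := IH b x1 fx1 pb1 ubp.
by exists x' => // v; rewrite net' net1 subrK.
Qed.

Hypothesis l_fin : forall e, l e != +oo%E.
Hypothesis u_fin : forall e, u e != -oo%E.
Hypothesis le_lu : forall e, (l e <= u e)%E.

Lemma feasible_exists : exists x, feasible x.
Proof.
(* The value 0 serves an arc with both bounds infinite. *)
exists (fun e => if l e is r%:E%E then r else if u e is r%:E%E then r else 0).
move=> e; have := l_fin e; have := u_fin e; have := le_lu e.
by case: (l e) (u e) => [r| |] [s| |] //=; rewrite ?lexx ?leey ?leNye // andbT.
Qed.

Lemma feasible_sum_net_le (x : E -> int) (U : {set V}) :
  feasible x -> ((\sum_(v in U) net x v)%:E <= cut U)%E.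
Proof.
move=> fx; rewrite sum_net -sumrN /cut EFinD -!sumEFin.
apply: leeD; apply: lee_sum => e _; first by case/andP: (fx e).
by rewrite EFinN leeN2; case/andP: (fx e).
Qed.

(* No residual edge leaves [U], so every edge of the cut is saturated. *)
Lemma closed_sum_net (x : E -> int) (U : {set V}) :
  feasible x -> (forall a b, a \in U -> residual x a b -> b \in U) ->
  (\sum_(v in U) net x v)%:E = cut U.
Proof.
move=> fx clU; rewrite sum_net -sumrN /cut EFinD -!sumEFin.
congr (_ + _)%E; apply: eq_bigr => e /andP[se te].
  apply/eqP; rewrite eq_le; have /andP[_ ->] := fx e; rewrite leNgt.
  apply: contra te => lt; apply: (clU _ _ se).
  by apply/existsP; exists e; rewrite !eqxx lt.
apply/eqP; rewrite EFinN eqe_opp eq_le; have /andP[-> _] := fx e; rewrite andbT leNgt.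
apply: contra se => lt; apply: (clU _ _ te).
by apply/existsP; exists e; rewrite !eqxx lt orbT.
Qed.

(** Sufficiency is by induction on the total deviation [dev] from [b]. If [a] falls short, either
    some vertex with an excess is reachable from [a] in the residual graph and a unit is pushed to
    it, or the reachable set violates the cut condition. *)
Lemma Hoffman_feasibility (b : V -> int) : \sum_v b v = 0 ->
  (exists2 x, feasible x & forall v, net x v = b v) <->
  (forall U : {set V}, ((\sum_(v in U) b v)%:E <= cut U)%E).
Proof.
move=> b0; split=> [[x fx nx] U|cutU].
  by rewrite -(eq_bigr _ (fun v _ => nx v)); exact: feasible_sum_net_le.
have [x0 fx0] := feasible_exists.
pose dev (x : E -> int) := (\sum_v `|(net x v - b v)%R|)%N.
have [k] := ubnP (dev x0); elim: k x0 fx0 => // k IH x fx ltk.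
have [/existsP[a lta]|/existsPn ge] := boolP [exists v, net x v < b v]; last first.
  exists x => // v; apply/eqP; rewrite -subr_eq0.
  (* Both [net x] and [b] sum to 0, so they agree once no vertex falls short. *)
  have /psumr_eq0P H : forall v, true -> 0 <= net x v - b v.
    by move=> w _; rewrite subr_ge0 leNgt ge.
  by rewrite H // sumrB sum_net_all b0 subr0.
pose U := [set v | connect (residual x) a v].
have aU : a \in U by rewrite inE connect0.
have [/existsP[w /andP[wU ltw]]|/existsPn ge] :=
    boolP [exists w, (w \in U) && (b w < net x w)]; last first.
  (* The cut of [U] equals its net outflow, which is less than its supply: [a] falls short and no
     vertex of [U] has an excess. *)
  have := cutU U; rewrite -(closed_sum_net fx); last first.
    by move=> c d; rewrite !inE => ac /connect1; exact: connect_trans.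
  rewrite lee_fin leNgt => /negP[].
  rewrite (bigD1 a aU) [ltRHS](bigD1 a aU) /=; apply: ltr_leD => //.
  apply: ler_sum => v /andP[vU _]; have := ge v.
  by rewrite (vU : v \in U) /= -leNgt.
move: wU; rewrite inE => /connectP[p0 pp0 wE].
case: (shortenP pp0) wE => p pp up _ wE.
have [x' fx' nx'] := push_path fx pp up.
apply: (IH x') => //; rewrite -ltnS; apply: leq_trans ltk; rewrite ltnS.
(* The term of [a] drops by one, that of [w] does not grow because [w] had an excess, and the others
   are unchanged. *)
rewrite /dev (bigD1 a) // [X in (_ < X)%N](bigD1 a) //= -addSn.
have aw : (a == w) = false by apply/eqP => aw; move: lta; rewrite aw ltNge ltW.
apply: leq_add; rewrite ?nx' -?wE ?eqxx ?aw; first by lia.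
apply: leq_sum => v va; rewrite nx' -wE (negbTE va); case: eqP => [->|_]; last by lia.
by lia.
Qed.

End Feasibility.

(** * Maximal segments *)

Section CyclicOrdinals.
Variable n : nat.
Implicit Types j : 'I_n.+1.

Lemma val_ord_pred j : j != ord0 -> ord_pred j = j.-1 :> nat.
Proof.
move=> j0; have jn := ltn_ord j; have {}j0 : (0 < j)%N by rewrite lt0n.
rewrite /= (_ : (j + n.+1).-1 = j.-1 + n.+1)%N; last by lia.
by rewrite modnDr modn_small //; lia.
Qed.

Lemma val_ordS j : j != ord_max -> ordS j = j.+1 :> nat.
Proof.
move=> jn; rewrite /= modn_small // ltn_neqAle ltnS -ltnS ltn_ord andbT.
by rewrite eqSS.
Qed.

Lemma ordS_max : ordS (@ord_max n) = ord0.
Proof. by apply/val_inj; rewrite /= modnn. Qed.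

Lemma ord_pred0 : ord_pred (@ord0 n) = ord_max.
Proof. by rewrite -ordS_max ordSK. Qed.

Lemma ordS_eq0 j : (ordS j == ord0) = (j == ord_max).
Proof. by rewrite -ordS_max (inj_eq (@ordS_inj _)). Qed.

End CyclicOrdinals.

(** * Maximal runs of a predicate on a line *)

Section Runs.
Variables (n : nat) (P : pred 'I_n.+1).
Implicit Types j : 'I_n.+1.

(** The boundary tests are explicit because [ord_pred] and [ordS] wrap around, whereas runs do
    not. *)
Definition run_start j := P j && ((j == ord0) || ~~ P (ord_pred j)).
Definition run_end j := P j && ((j == ord_max) || ~~ P (ordS j)).

Definition maximal_run j1 j2 : bool :=
  [&& (j1 <= j2)%N, [forall j : 'I_n.+1, (j1 <= j <= j2)%N ==> P j],
      run_start j1 & run_end j2].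

(** Otherwise the run with the earlier start contains the predecessor of the later start, where [P]
    fails. *)
Lemma maximal_run_start_inj j1 j1' j2 :
  maximal_run j1 j2 -> maximal_run j1' j2 -> j1 = j1'.
Proof.
wlog lt : j1 j1' / (j1 < j1')%N => [W r r'|].
  case: (ltngtP j1 j1') => [lt|gt|/val_inj//]; first exact: W lt r r'.
  by apply/esym; apply: W gt r' r.
case/and4P=> _ /forallP all1 _ _ /and4P[le' _ /andP[_ /orP[/eqP j0|nP]] _].
  by rewrite j0 in lt.
have j0 : j1' != ord0 by apply: contraTneq lt => ->.
case/negP: nP; apply: (implyP (all1 _)); rewrite (val_ord_pred j0).
by lia.
Qed.

Lemma maximal_run_end_inj j1 j2 j2' :
  maximal_run j1 j2 -> maximal_run j1 j2' -> j2 = j2'.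
Proof.
wlog lt : j2 j2' / (j2 < j2')%N => [W r r'|].
  case: (ltngtP j2 j2') => [lt|gt|/val_inj//]; first exact: W lt r r'.
  by apply/esym; apply: W gt r' r.
case/and4P=> le _ _ /andP[_ /orP[/eqP jn|nP]] /and4P[_ /forallP all2 _ _].
  by move: lt; rewrite jn ltnNge -ltnS ltn_ord.
have jn : j2 != ord_max.
  by apply: contraTneq lt => ->; rewrite -leqNgt -ltnS ltn_ord.
case/negP: nP; apply: (implyP (all2 _)); rewrite (val_ordS jn).
by lia.
Qed.

Lemma run_end_has_start j2 : run_end j2 -> exists j1, maximal_run j1 j2.
Proof.
move=> e2; have Pj2 : P j2 by case/andP: e2.
(* The least index satisfying [Q] is a run start, since a predecessor in [P] would satisfy [Q]
   too. *)
pose Q j1 := (j1 <= j2)%N && [forall j : 'I_n.+1, (j1 <= j <= j2)%N ==> P j].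
have Q2 : Q j2.
  rewrite /Q leqnn; apply/forallP => j; apply/implyP => H.
  by have -> : j = j2 by apply/val_inj => /=; lia.
case: (arg_minnP (fun j : 'I_n.+1 => j : nat) Q2) => j1 /andP[le1 all1] min1.
exists j1; rewrite /maximal_run le1 all1 e2 andbT /run_start.
have -> : P j1 by move/forallP/(_ j1): all1; rewrite leqnn le1.
apply/norP => -[j0]; rewrite negbK => Pp.
have vp := val_ord_pred j0; have j1p : (0 < j1)%N by rewrite lt0n.
suff /min1 : Q (ord_pred j1) by rewrite vp; lia.
apply/andP; split; first by rewrite vp; lia.
apply/forallP => j; apply/implyP => /andP[lej lej2].
have [jE|jp] := eqVneq j (ord_pred j1); first by rewrite jE.
move/forallP/(_ j)/implyP: all1; apply; rewrite lej2 andbT.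
move: lej; rewrite leq_eqVlt val_eqE eq_sym (negbTE jp) vp; lia.
Qed.

Lemma run_start_has_end j1 : run_start j1 -> exists j2, maximal_run j1 j2.
Proof.
move=> s1; have Pj1 : P j1 by case/andP: s1.
pose Q j2 := (j1 <= j2)%N && [forall j : 'I_n.+1, (j1 <= j <= j2)%N ==> P j].
have Q1 : Q j1.
  rewrite /Q leqnn; apply/forallP => j; apply/implyP => H.
  by have -> : j = j1 by apply/val_inj => /=; lia.
case: (arg_maxnP (fun j : 'I_n.+1 => j : nat) Q1) => j2 /andP[le2 all2] max2.
exists j2; rewrite /maximal_run le2 all2 s1 /run_end /=.
have -> : P j2 by move/forallP/(_ j2): all2; rewrite leqnn le2.
apply/norP => -[jn]; rewrite negbK => Ps.
have vs := val_ordS jn.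
suff /max2 : Q (ordS j2) by rewrite vs; lia.
apply/andP; split; first by rewrite vs; lia.
apply/forallP => j; apply/implyP => /andP[lej lej2].
have [jE|jp] := eqVneq j (ordS j2); first by rewrite jE.
move/forallP/(_ j)/implyP: all2; apply; rewrite lej /=.
move: lej2; rewrite leq_eqVlt val_eqE (negbTE jp) vs; lia.
Qed.

Local Open Scope ereal_scope.

(** Starts and ends of runs are in bijection, so the double sum collapses separately for [F] and for
    [G]. *)
Lemma sum_maximal_run (F G : 'I_n.+1 -> \bar int) :
  \sum_j1 \sum_(j2 | maximal_run j1 j2) (F j2 + G j1) =
  \sum_(j | run_end j) F j + \sum_(j | run_start j) G j.
Proof.
under eq_bigr do rewrite big_split; rewrite big_split /=; congr (_ + _).
  rewrite (exchange_big_dep run_end) /=; last by move=> j1 j2 _ /and4P[].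
  apply: eq_bigr => j2 /run_end_has_start[j1 r1].
  rewrite (big_pred1 j1) // => j /=; apply/idP/eqP => [r|-> //].
  exact: maximal_run_start_inj r r1.
rewrite [RHS]big_mkcond /=; apply: eq_bigr => j1 _.
case: ifPn => [/run_start_has_end[j2 r2]|ns].
  rewrite (big_pred1 j2) // => j /=; apply/idP/eqP => [r|-> //].
  exact: maximal_run_end_inj r r2.
by rewrite big_pred0 // => j2; apply/and4P => -[_ _ s _]; rewrite s in ns.
Qed.

(* [ordS ord_max] is [ord0]: the last term corrects for the run through [ord0],
   which need not start at [ord0] when the indices are read cyclically. *)
Lemma sum_maximal_run_cyclic (F G : 'I_n.+1 -> \bar int) (c : int) :
  F ord_max = c%:E -> G ord_max = c%:E ->
  \sum_j1 \sum_(j2 | maximal_run j1 j2)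
     (F j2 - (if j1 == ord0 then 0 else G (ord_pred j1))) =
  \sum_(j | P j && ~~ P (ordS j)) F j
  + \sum_(j | ~~ P j && P (ordS j)) - G j + (if P ord0 then c%:E else 0).
Proof.
move=> Fc Gc; rewrite sum_maximal_run.
rewrite [X in _ + X = _](reindex_inj (@ordS_inj _)) /=.
(* With starts indexed by their cyclic predecessor, the linear and cyclic tests differ only at
   [ord_max], so that term is split off from all four sums. *)
have split_max (Q : pred 'I_n.+1) (K : 'I_n.+1 -> \bar int) :
    \sum_(j | Q j) K j =
    (if Q ord_max then K ord_max else 0) + \sum_(j | Q j && (j != ord_max)) K j.
  case: ifPn => [Qm|nQm]; first by rewrite (bigD1 ord_max).
  rewrite add0e; apply: eq_bigl => j.
  by case: eqVneq => [->|_]; rewrite ?(negbTE nQm) ?andbT.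
rewrite (split_max run_end) (split_max (fun j => run_start (ordS j))).
rewrite (split_max (fun j => P j && _)) (split_max (fun j => ~~ P j && _)).
set A := \sum_(j | run_end j && _) _.
set B := \sum_(j | run_start (ordS j) && _) _.
set A' := \sum_(j | P j && _ && _) _.
set B' := \sum_(j | ~~ P j && _ && _) _.
have <- : A = A'.
  by apply: eq_bigl => j; rewrite /run_end; case: eqP; rewrite ?andbF.
have <- : B = B'.
  apply: eq_big => [j|j /andP[_ jn]]; last by rewrite ordS_eq0 (negbTE jn) ordSK.
  rewrite /run_start ordS_eq0 ordSK; case: eqP; rewrite ?andbF //=.
  by rewrite !andbT andbC.
rewrite /run_end /run_start !ordS_max !eqxx !andbT Fc Gc oppe0 if_same add0e.
(* If [P] holds at both ends, the linear run end at [ord_max] contributes the [c] of the correction.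
   If it holds only at [ord0], the cyclic start contributes [- c], which the correction cancels as
   [c] is finite. *)
case: (P ord_max); case: (P ord0) => /=; rewrite ?add0e ?adde0 //.
- by rewrite -addeA addeC.
- by rewrite [X in _ = _ + X + _]addeC -!addeA -EFinD addNr adde0.
Qed.

End Runs.

(** * Horizontal segments as runs within a row *)

Section SegmentSums.
Variables m n : nat.
Local Notation cell := ('I_m.+1 * 'I_n.+1)%type.
Implicit Types X Y : {set cell}.

Lemma hseg_sub (i i' : 'I_m.+1) (j1 j2 k1 k2 : 'I_n.+1) : (j1 <= j2)%N ->
  hseg i j1 j2 \subset hseg i' k1 k2 -> [/\ i = i', (k1 <= j1)%N & (j2 <= k2)%N].
Proof.
move=> le12 /subsetP sub.
have := sub (i, j1); have := sub (i, j2).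
rewrite !inE /= !eqxx !leqnn !le12 => /(_ isT) /and3P[/eqP-> _ ->].
by move=> /(_ isT) /and3P[_ -> _].
Qed.

(** One-cell extensions detect non-maximality: a larger segment inside [X] lies in the same row and
    contains a cell adjacent to an end. *)
Lemma mem_Iho X (i : 'I_m.+1) (j1 j2 : 'I_n.+1) :
  (j1 <= j2)%N && (hseg i j1 j2 \in Iho X) =
  maximal_run (fun j => (i, j) \in X) j1 j2.
Proof.
rewrite inE /maximal_run; case: (leqP j1 j2) => //= le12.
have hsegX k1 k2 : (hseg i k1 k2 \subset X) =
    [forall j : 'I_n.+1, (k1 <= j <= k2)%N ==> ((i, j) \in X)].
  apply/subsetP/forallP => [sub j|al [a j]].
    by apply/implyP => H; apply: sub; rewrite inE /= eqxx.
  by rewrite inE /= => /andP[/eqP-> H]; exact: (implyP (al j)).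
have is_hsegP (k1 k2 : 'I_n.+1) : (k1 <= k2)%N -> is_hseg (hseg i k1 k2).
  move=> le; apply/existsP; exists i; apply/existsP; exists k1.
  by apply/existsP; exists k2; rewrite le eqxx.
apply/maxsetP/idP.
  rewrite hsegX => -[/andP[_ al] mx]; rewrite al /=.
  have Xi (j : 'I_n.+1) : (j1 <= j <= j2)%N -> (i, j) \in X := implyP (forallP al j).
  apply/andP; split; (apply/andP; split; first by apply: Xi; rewrite leqnn le12).
    apply/norP => -[j0]; rewrite negbK => Xp.
    have vp := val_ord_pred j0; have j1p : (0 < j1)%N by rewrite lt0n.
    have /mx : is_hseg (hseg i (ord_pred j1) j2) && (hseg i (ord_pred j1) j2 \subset X).
      rewrite is_hsegP ?vp; last by lia.
      rewrite hsegX; apply/forallP => j; apply/implyP => /andP[lej lej2].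
      have [->//|jp] := eqVneq j (ord_pred j1); apply: Xi; rewrite lej2 andbT.
      move: lej; rewrite leq_eqVlt val_eqE eq_sym (negbTE jp) vp; lia.
    move=> eqs; have: hseg i (ord_pred j1) j2 = hseg i j1 j2.
      apply: eqs; apply/subsetP => -[a j]; rewrite !inE vp => /and3P[-> /= ? ->].
      by rewrite andbT; lia.
    move/setP/(_ (i, ord_pred j1)); rewrite !inE [(_, _).1]/= [(_, _).2]/= eqxx vp; lia.
  apply/norP => -[jn]; rewrite negbK => Xs.
  have vs := val_ordS jn.
  have /mx : is_hseg (hseg i j1 (ordS j2)) && (hseg i j1 (ordS j2) \subset X).
    rewrite is_hsegP ?vs; last by lia.
    rewrite hsegX; apply/forallP => j; apply/implyP => /andP[lej lej2].
    have [->//|jp] := eqVneq j (ordS j2); apply: Xi; rewrite lej /=.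
    move: lej2; rewrite leq_eqVlt val_eqE (negbTE jp) vs; lia.
  move=> eqs; have: hseg i j1 (ordS j2) = hseg i j1 j2.
    apply: eqs; apply/subsetP => -[a j]; rewrite !inE vs => /and3P[-> -> /= ?].
    by lia.
  move/setP/(_ (i, ordS j2)); rewrite !inE [(_, _).1]/= [(_, _).2]/= eqxx vs; lia.
case/and3P=> al /andP[_ st] /andP[_ en].
rewrite hsegX al is_hsegP //; split=> // Y /andP[/existsP[a /existsP[k1 /existsP[k2]]]].
case/andP=> le /eqP -> sub /(hseg_sub le12)[ia le1 le2]; subst a.
move: sub; rewrite hsegX => /forallP al'.
have kX (j : 'I_n.+1) : (k1 <= j <= k2)%N -> (i, j) \in X := implyP (al' j).
suff [-> ->] : k1 = j1 /\ k2 = j2 by [].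
split; apply/eqP.
  have [//|ne] := eqVneq k1 j1.
  have lt1 : (k1 < j1)%N by rewrite ltn_neqAle le1 andbT val_eqE.
  have j0 : j1 != ord0 by apply: contraTneq lt1 => ->.
  by move: st; rewrite (negbTE j0) kX // (val_ord_pred j0); lia.
have [//|ne] := eqVneq k2 j2.
have lt2 : (j2 < k2)%N by rewrite ltn_neqAle le2 andbT eq_sym val_eqE.
have jn : j2 != ord_max.
  by apply: contraTneq lt2 => ->; rewrite -leqNgt -ltnS ltn_ord.
by move: en; rewrite (negbTE jn) kX // (val_ordS jn); lia.
Qed.

Local Open Scope ereal_scope.

(** The first two sums are the contributions to a cut of the row arcs leaving and entering [X]. The
    last one will be matched by the supplies in the first column. *)
Lemma bstar1_cyclic (Phi Gamma : 'M[\bar int]_(m.+1, n.+1)) (c : 'I_m.+1 -> int) X :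
  (forall i, Phi i ord_max = (c i)%:E) -> (forall i, Gamma i ord_max = (c i)%:E) ->
  bstar1 Phi Gamma X =
  \sum_(s : cell | (s \in X) && ((s.1, ordS s.2) \notin X)) Gamma s.1 s.2
  + \sum_(s : cell | (s \notin X) && ((s.1, ordS s.2) \in X)) - Phi s.1 s.2
  + (\sum_(i | (i, ord0) \in X) c i)%R%:E.
Proof.
move=> Phic Gammac; rewrite /bstar1.
under eq_bigr => i _.
  under eq_bigr => j1 _ do under eq_bigl => j2 do rewrite mem_Iho.
  rewrite (@sum_maximal_run_cyclic n _ _ _ (c i)) //.
  over.
rewrite !big_split /= !pair_big_dep /= -sumEFin; congr (_ + _ + _).
- by apply: eq_bigl => -[i j].
- by apply: eq_bigl => -[i j].
- by rewrite [RHS]big_mkcond.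
Qed.

End SegmentSums.

(** * Vertical segments by transposition *)

Definition transpose_set (m n : nat) (X : {set 'I_m * 'I_n}) :
    {set 'I_n * 'I_m} :=
  [set s | (s.2, s.1) \in X].

Section Transposition.
Variables m n : nat.
Implicit Types X Y : {set 'I_m * 'I_n}.

Lemma transpose_setK : cancel (@transpose_set m n) (@transpose_set n m).
Proof. by move=> X; apply/setP => -[i j]; rewrite !inE. Qed.

Lemma transpose_setS X Y : (transpose_set X \subset transpose_set Y) = (X \subset Y).
Proof.
apply/subsetP/subsetP => sub [i j]; first by move: (sub (j, i)); rewrite !inE.
by rewrite !inE; apply: sub.
Qed.

Lemma transpose_vseg i1 i2 j :
  transpose_set (@vseg m n i1 i2 j) = hseg j i1 i2.
Proof. by apply/setP => -[a b]; rewrite !inE /= andbC. Qed.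

Lemma is_hseg_transpose Y : is_hseg (transpose_set Y) = is_vseg Y.
Proof.
have tv i1 i2 j : (transpose_set Y == hseg j i1 i2) = (Y == vseg i1 i2 j).
  by rewrite -transpose_vseg (can_eq transpose_setK).
apply/existsP/existsP => [[j /existsP[i1 /existsP[i2]]]|[i1 /existsP[i2 /existsP[j]]]].
  by rewrite tv => H; exists i1; apply/existsP; exists i2; apply/existsP; exists j.
by rewrite -tv => H; exists j; apply/existsP; exists i1; apply/existsP; exists i2.
Qed.

End Transposition.

Lemma mem_Iho_transpose (m n : nat) (X Y : {set 'I_m * 'I_n}) :
  (transpose_set Y \in Iho (transpose_set X)) = (Y \in Ive X).
Proof.
rewrite !inE; apply/maxsetP/maxsetP => -[].
  rewrite is_hseg_transpose transpose_setS => -> mx; split=> // Z.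
  rewrite -is_hseg_transpose -(transpose_setS Z) -(transpose_setS Y) => HZ sub.
  by apply/(can_inj (@transpose_setK m n)); apply: mx.
rewrite is_hseg_transpose transpose_setS => -> mx; split=> // Z.
rewrite -[Z](transpose_setK) is_hseg_transpose !transpose_setS => HZ sub.
by congr transpose_set; apply: mx.
Qed.

Local Open Scope ereal_scope.

Lemma bstar2_transpose (m n : nat) (Phi Gamma : 'M[\bar int]_(m, n)) X :
  bstar2 Phi Gamma X = bstar1 Phi^T%R Gamma^T%R (transpose_set X).
Proof.
apply: eq_bigr => j _; apply: eq_bigr => i1 _.
apply: eq_big => [i2|i2 _]; first by rewrite -transpose_vseg mem_Iho_transpose.
by rewrite /before2 /before1 !mxE.
Qed.

Lemma bstar2_cyclic (m n : nat) (Phi Gamma : 'M[\bar int]_(m.+1, n.+1))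
    (c : 'I_n.+1 -> int) X :
  (forall j, Phi ord_max j = (c j)%:E) -> (forall j, Gamma ord_max j = (c j)%:E) ->
  bstar2 Phi Gamma X =
  \sum_(s : 'I_m.+1 * 'I_n.+1 | (s \in X) && ((ordS s.1, s.2) \notin X)) Gamma s.1 s.2
  + \sum_(s : 'I_m.+1 * 'I_n.+1 | (s \notin X) && ((ordS s.1, s.2) \in X)) - Phi s.1 s.2
  + (\sum_(j | (ord0, j) \in X) c j)%R%:E.
Proof.
move=> Phic Gammac; rewrite bstar2_transpose (@bstar1_cyclic _ _ _ _ c); first last.
- by move=> j; rewrite mxE.
- by move=> j; rewrite mxE.
have swapK a b : cancel (fun s : 'I_a * 'I_b => (s.2, s.1)) (fun s => (s.2, s.1)).
  by case.
congr (_ + _ + _).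
- rewrite (reindex _ (onW_bij _ (Bijective (@swapK m.+1 n.+1) (@swapK n.+1 m.+1)))) /=.
  by apply: eq_big => [[i j]|[i j] _]; rewrite ?inE ?mxE.
- rewrite (reindex _ (onW_bij _ (Bijective (@swapK m.+1 n.+1) (@swapK n.+1 m.+1)))) /=.
  by apply: eq_big => [[i j]|[i j] _]; rewrite ?inE ?mxE.
- by congr (_%:E)%E; apply: eq_bigl => j; rewrite inE.
Qed.

(** * The network of a prefix-bounded matrix *)

Section PrefixSums.
Local Open Scope ring_scope.

Lemma sum_prefix1 (m n : nat) (x : 'M[int]_(m, n.+1)) i j :
  \sum_(s in prefix1 i j) x s.1 s.2 =
  x i j + (if j == ord0 then 0
           else \sum_(s in prefix1 i (ord_pred j)) x s.1 s.2).
Proof.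
rewrite (bigD1 (i, j)) ?inE /= ?eqxx ?leqnn //; congr (_ + _).
case: eqVneq => [->|j0].
  rewrite big_pred0 // => -[a b]; rewrite !inE /= xpair_eqE.
  by case: eqP => //= _; rewrite leqn0 -[0%N]/(val (@ord0 n)) val_eqE andbN.
apply: eq_bigl => -[a b]; rewrite !inE val_ord_pred // [(_, _).1]/= [(_, _).2]/=.
rewrite xpair_eqE; case: eqP => //= _; rewrite -val_eqE /=.
by move: j0; rewrite -val_eqE /=; lia.
Qed.

(** This recovers prefix sums from flow conservation: the recursion determines [p] by induction on
    the column. *)
Lemma sum_prefix1_unique (m n : nat) (x : 'M[int]_(m, n.+1)) (i : 'I_m)
    (p : 'I_n.+1 -> int) :
  (forall j, p j = x i j + (if j == ord0 then 0 else p (ord_pred j))) ->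
  forall j, p j = \sum_(s in prefix1 i j) x s.1 s.2.
Proof.
move=> rec j; have [k] := ubnP j; elim: k j => // k IH j jk.
rewrite rec sum_prefix1; case: eqVneq => // j0; rewrite IH // val_ord_pred //.
by move: j0; rewrite -val_eqE /=; lia.
Qed.

Lemma sum_prefix2 (m n : nat) (x : 'M[int]_(m, n)) i j :
  \sum_(s in prefix2 i j) x s.1 s.2 = \sum_(s in prefix1 j i) x^T s.1 s.2.
Proof.
rewrite (reindex (fun s : 'I_n * 'I_m => (s.2, s.1))) /=.
  by apply: eq_big => [[a b]|[a b] _]; rewrite ?inE ?mxE //= andbC.
by exists (fun s => (s.2, s.1)) => -[].
Qed.

End PrefixSums.

Section Network.
Variables m n : nat.
Local Notation cell := ('I_m.+1 * 'I_n.+1)%type.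

(* Each cell has a row vertex [inl s] and a column vertex [inr s].  The arc
   [inl (inl s)] carries the row prefix sum ending at [s] to the cyclically next
   row vertex, [inl (inr s)] carries the entry [s] from its column vertex to its
   row vertex, and [inr s] carries the column prefix sum ending at [s] from the
   cyclically next column vertex. *)
Definition node : finType := (cell + cell)%type.
Definition arc : finType := (cell + cell + cell)%type.

Definition arc_src (e : arc) : node :=
  match e with
  | inl (inl s) => inl s
  | inl (inr s) => inr s
  | inr s => inr (ordS s.1, s.2)
  end.

Definition arc_tgt (e : arc) : node :=
  match e with
  | inl (inl s) => inl (s.1, ordS s.2)
  | inl (inr s) => inl s
  | inr s => inr s
  end.

Definition arc_fun T (a1 a0 a2 : 'M[T]_(m.+1, n.+1)) (e : arc) : T :=
  match e with
  | inl (inl s) => a1 s.1 s.2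
  | inl (inr s) => a0 s.1 s.2
  | inr s => a2 s.1 s.2
  end.

Variables (c1 : 'I_m.+1 -> int) (c2 : 'I_n.+1 -> int).

(* The wrap-around arcs carry the prescribed full row and column sums. *)
Definition supply (v : node) : int :=
  match v with
  | inl s => if s.2 == ord0 then (- c1 s.1)%R else 0%R
  | inr s => if s.1 == ord0 then c2 s.2 else 0%R
  end.

Local Open Scope ring_scope.

Lemma net_row (p x q : 'M[int]_(m.+1, n.+1)) i j :
  net arc_src arc_tgt (arc_fun p x q) (inl (i, j)) =
  p i j - (p i (ord_pred j) + x i j).
Proof.
rewrite /net !big_sumType /=.
rewrite (big_pred1 (i, j)) => [|s]; last exact: (inj_eq inl_inj).
rewrite ![\sum_(_ | inr _ == inl _) _]big_pred0 // !addr0.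
rewrite (big_pred1 (i, ord_pred j)) => [|[a b]]; last first.
  rewrite /= (inj_eq inl_inj) !xpair_eqE; congr andb.
  by rewrite -{1}(ord_predK j) (inj_eq (@ordS_inj _)).
by rewrite (big_pred1 (i, j)) => [|s]; last exact: (inj_eq inl_inj).
Qed.

Lemma net_col (p x q : 'M[int]_(m.+1, n.+1)) i j :
  net arc_src arc_tgt (arc_fun p x q) (inr (i, j)) =
  x i j + q (ord_pred i) j - q i j.
Proof.
rewrite /net !big_sumType /=.
rewrite ![\sum_(_ | inl _ == inr _) _]big_pred0 // !add0r.
rewrite (big_pred1 (i, j)) => [|s]; last exact: (inj_eq inr_inj).
rewrite (big_pred1 (ord_pred i, j)) => [|[a b]]; last first.
  rewrite /= (inj_eq inr_inj) !xpair_eqE; congr andb.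
  by rewrite -{1}(ord_predK i) (inj_eq (@ordS_inj _)).
by rewrite (big_pred1 (i, j)) => [|s]; last exact: (inj_eq inr_inj).
Qed.

Lemma arc_funE T (y : arc -> T) :
  arc_fun (\matrix_(i, j) y (inl (inl (i, j)))) (\matrix_(i, j) y (inl (inr (i, j))))
    (\matrix_(i, j) y (inr (i, j))) =1 y.
Proof. by move=> [[[i j]|[i j]]|[i j]] /=; rewrite mxE. Qed.

Variables Phi1 Gamma1 Phi2 Gamma2 f g : 'M[\bar int]_(m.+1, n.+1).
Hypothesis Phi1_max : forall i, Phi1 i ord_max = (c1 i)%:E%E.
Hypothesis Gamma1_max : forall i, Gamma1 i ord_max = (c1 i)%:E%E.
Hypothesis Phi2_max : forall j, Phi2 ord_max j = (c2 j)%:E%E.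
Hypothesis Gamma2_max : forall j, Gamma2 ord_max j = (c2 j)%:E%E.

(** With the column side complemented, the entry arc of [s] leaves the cut when [s] avoids both sets
    and enters it when [s] lies in both. As column arcs run backwards, they leave at the lower ends
    of the vertical segments of [X'']. *)
Definition cut_side (X' X'' : {set cell}) : {set node} :=
  [set v | match v with inl s => s \in X' | inr s => s \notin X'' end].

(** The full sum of [c2] will be [H]; the subtracted sums are the cyclic corrections of [bstar1] and
    [bstar2]. *)
Lemma sum_supply (X' X'' : {set cell}) :
  \sum_(v in cut_side X' X'') supply v =
  \sum_j c2 j - \sum_(i | (i, ord0) \in X') c1 i - \sum_(j | (ord0, j) \in X'') c2 j.
Proof.
rewrite /cut_side big_sumType /= [RHS]addrAC [RHS]addrC; congr (_ + _).
  under eq_bigl do rewrite inE.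
  rewrite big_mkcond -sumrN [RHS]big_mkcond /=.
  transitivity (\sum_i \sum_j (if (i, j) \in X' then
      if j == ord0 then - c1 i else 0 else 0)).
    by rewrite pair_bigA; apply: eq_bigr => -[].
  apply: eq_bigr => i _.
  rewrite (bigD1 ord0) //= big1 ?addr0 // => j /negbTE ->.
  by rewrite if_same.
under eq_bigl do rewrite inE.
rewrite [X in X - _](bigID (fun j => (ord0, j) \in X'')) /= [RHS]addrC addKr.
rewrite big_mkcond [RHS]big_mkcond /=.
transitivity (\sum_i \sum_j (if (i, j) \notin X'' then
    if i == ord0 then c2 j else 0 else 0)).
  by rewrite pair_bigA; apply: eq_bigr => -[].
rewrite exchange_big /=; apply: eq_bigr => j _.
rewrite (bigD1 ord0) //= big1 ?addr0 // => i /negbTE ->.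
by rewrite if_same.
Qed.

(** Coinciding bounds force the wrap-around arcs to carry [c1] and [c2]. The supplies offset these
    amounts at the first cells, so conservation there starts the prefix recursion from 0. *)
Lemma prefix_bounded_flow :
  (exists x : 'M[int]_(m.+1, n.+1),
     prefix_bounded Phi1 Gamma1 Phi2 Gamma2 x /\
     (forall i j, (f i j <= (x i j)%:E <= g i j)%E)) <->
  (exists2 y, feasible (arc_fun Phi1 f Phi2) (arc_fun Gamma1 g Gamma2) y
    & forall v, net arc_src arc_tgt y v = supply v).
Proof.
split=> [[x [pb xfg]]|[y fy ny]].
  pose p := \matrix_(i, j) \sum_(s in @prefix1 m.+1 n.+1 i j) x s.1 s.2.
  pose q := \matrix_(i, j) \sum_(s in @prefix2 m.+1 n.+1 i j) x s.1 s.2.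
  exists (arc_fun p x q).
    by move=> [[[i j]|[i j]]|[i j]] /=; rewrite ?mxE; case: (pb i j).
  have tight1 i : p i ord_max = c1 i.
    apply/eqP; rewrite eq_le -!lee_fin -{1}Gamma1_max -Phi1_max mxE andbC.
    by case: (pb i ord_max).
  have tight2 j : q ord_max j = c2 j.
    apply/eqP; rewrite eq_le -!lee_fin -{1}Gamma2_max -Phi2_max mxE andbC.
    by case: (pb ord_max j).
  move=> [[i j]|[i j]]; rewrite ?net_row ?net_col /=.
    case: eqVneq => [->|j0].
      by rewrite ord_pred0 tight1 mxE sum_prefix1 eqxx addr0 opprD addrCA subrr addr0.
    by rewrite !mxE sum_prefix1 (negbTE j0) [in X in _ - X]addrC subrr.
  case: eqVneq => [->|i0].
    by rewrite ord_pred0 tight2 mxE sum_prefix2 sum_prefix1 eqxx addr0 mxE addrAC subrr add0r.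
  by rewrite !mxE !sum_prefix2 [X in _ - X]sum_prefix1 (negbTE i0) mxE subrr.
pose p := \matrix_(i, j) y (inl (inl (i, j))).
pose x := \matrix_(i, j) y (inl (inr (i, j))).
pose q := \matrix_(i, j) y (inr (i, j)).
have yE : arc_fun p x q =1 y := arc_funE y.
have fE e : ((arc_fun Phi1 f Phi2 e) <= (arc_fun p x q e)%:E <= (arc_fun Gamma1 g Gamma2 e))%E.
  by rewrite yE; exact: fy.
have nE v : net arc_src arc_tgt (arc_fun p x q) v = supply v by rewrite (eq_net _ _ yE).
have tight1 i : p i ord_max = c1 i.
  apply/eqP; rewrite eq_le -!lee_fin -{1}Gamma1_max -Phi1_max andbC.
  exact: (fE (inl (inl (i, ord_max)))).
have tight2 j : q ord_max j = c2 j.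
  apply/eqP; rewrite eq_le -!lee_fin -{1}Gamma2_max -Phi2_max andbC.
  exact: (fE (inr (ord_max, j))).
have pE i : forall j, p i j = \sum_(s in prefix1 i j) x s.1 s.2.
  apply: sum_prefix1_unique => j; have := nE (inl (i, j)); rewrite net_row /=.
  by case: eqVneq => [->|_]; rewrite ?ord_pred0 ?tight1; lia.
have qE j : forall i, q i j = \sum_(s in prefix1 j i) x^T s.1 s.2.
  apply: (@sum_prefix1_unique _ _ x^T j (fun i => q i j)) => i.
  have xT : x^T j i = x i j by rewrite [LHS]mxE.
  have := nE (inr (i, j)); rewrite net_col xT /=.
  by case: eqVneq => [->|_]; rewrite ?ord_pred0 ?tight2; lia.
exists x; split=> i j; last exact: (fE (inl (inr (i, j)))).
rewrite sum_prefix2 -pE -qE; split; first exact: (fE (inl (inl (i, j)))).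
exact: (fE (inr (i, j))).
Qed.

Hypothesis f_fin : forall i j, f i j != +oo%E.

Lemma cut_bstar (X' X'' : {set cell}) :
  (cut arc_src arc_tgt (arc_fun Phi1 f Phi2) (arc_fun Gamma1 g Gamma2) (cut_side X' X'')
   + (\sum_(i | (i, ord0) \in X') c1 i + \sum_(j | (ord0, j) \in X'') c2 j)%:E =
   bstar1 Phi1 Gamma1 X' + bstar2 Phi2 Gamma2 X''
     + tilde g (~: X' :&: ~: X'') - tilde f (X' :&: X''))%E.
Proof.
rewrite (@bstar1_cyclic _ _ _ _ c1) // (@bstar2_cyclic _ _ _ _ c2) //.
(* Negation distributes over this sum because no entry of [f] is [+oo], so opposite infinities never
   meet. *)
rewrite /tilde -sumeN; last first.
  move=> s t _ _; have := f_fin s.1 s.2; have := f_fin t.1 t.2.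
  by case: (f s.1 s.2) (f t.1 t.2) => [?||] [?||].
rewrite /cut /cut_side !big_sumType /= EFinD.
(* The upper sums, the lower sums and the corrections are regrouped by kind of arc: row, column,
   then the two entry sums. *)
rewrite [LHS](AC (3*3*2) ((1*4*7)*(3*6*8)*2*5))%AC.
by congr (_ + _ + _ + (_ + _ + _) + _ + _)%E;
  apply: eq_bigl => s; rewrite !inE ?negbK // andbC.
Qed.

End Network.

(** * From the cut condition to the inequality *)

Theorem theorem5p9 (m n : nat)
    (Phi1 Gamma1 Phi2 Gamma2 : 'M[\bar int]_(m.+1, n.+1))
    (hPhi1 : forall i j, Phi1 i j != +oo)
    (hGamma1 : forall i j, Gamma1 i j != -oo)
    (hPhi2 : forall i j, Phi2 i j != +oo)
    (hGamma2 : forall i j, Gamma2 i j != -oo)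
    (hle1 : forall i j, Phi1 i j <= Gamma1 i j)
    (hle2 : forall i j, Phi2 i j <= Gamma2 i j)
    (hlast1 : forall i, Phi1 i ord_max = Gamma1 i ord_max)
    (hlast2 : forall j, Phi2 ord_max j = Gamma2 ord_max j)
    (H : \bar int)
    (hH1 : H = \sum_(i < m.+1) Phi1 i ord_max)
    (hH2 : H = \sum_(j < n.+1) Phi2 ord_max j)
    (f g : 'M[\bar int]_(m.+1, n.+1))
    (hf : forall i j, f i j != +oo)
    (hg : forall i j, g i j != -oo)
    (hfg : forall i j, f i j <= g i j) :
  (exists x : 'M[int]_(m.+1, n.+1),
     prefix_bounded Phi1 Gamma1 Phi2 Gamma2 x /\
     (forall i j, f i j <= (x i j)%:E <= g i j))
  <->
  (forall X' X'' : {set 'I_m.+1 * 'I_n.+1},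
     H <= bstar1 Phi1 Gamma1 X' + bstar2 Phi2 Gamma2 X''
          + tilde g (~: X' :&: ~: X'') - tilde f (X' :&: X'')).
Proof.
pose c1 i := fine (Phi1 i ord_max); pose c2 j := fine (Phi2 ord_max j).
(* The common value is finite: [Phi1] excludes [+oo] and [Gamma1] excludes [-oo]. *)
have P1 i : Phi1 i ord_max = (c1 i)%:E.
  rewrite /c1; have := hPhi1 i ord_max; have := hGamma1 i ord_max.
  by rewrite -hlast1; case: (Phi1 i ord_max).
have P2 j : Phi2 ord_max j = (c2 j)%:E.
  rewrite /c2; have := hPhi2 ord_max j; have := hGamma2 ord_max j.
  by rewrite -hlast2; case: (Phi2 ord_max j).
have G1 i : Gamma1 i ord_max = (c1 i)%:E by rewrite -hlast1.
have G2 j : Gamma2 ord_max j = (c2 j)%:E by rewrite -hlast2.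
have H1 : H = (\sum_i c1 i)%R%:E by rewrite hH1 -sumEFin; apply: eq_bigr.
have H2 : H = (\sum_j c2 j)%R%:E by rewrite hH2 -sumEFin; apply: eq_bigr.
have supply0 : (\sum_v supply c1 c2 v = 0)%R.
  (* This choice of sets makes the cut side the whole vertex set; both remaining sums equal [H]. *)
  have := sum_supply c1 c2 [set: _] set0.
  rewrite /cut_side (eq_bigl xpredT) => [->|[s|s]]; rewrite ?inE //.
  under [X in (_ - X - _)%R]eq_bigl do rewrite inE.
  rewrite [X in (_ - X)%R]big_pred0 => [|j]; last by rewrite inE.
  by rewrite subr0; apply/eqP; rewrite subr_eq0 -eqe -H2 -H1.
rewrite (prefix_bounded_flow _ _ P1 G1 P2 G2) Hoffman_feasibility //; first last.
- by move=> [[s|s]|s] /=.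
- by move=> [[s|s]|s] /=.
- by move=> [[s|s]|s] /=.
have cutE X' X'' := cut_bstar (Phi1 := Phi1) (Gamma1 := Gamma1) (Phi2 := Phi2)
  (Gamma2 := Gamma2) g P1 G1 P2 G2 hf X' X''.
split=> [cutU X' X''|cond U].
  (* The finite corrections move across the inequality and turn [H] into the supply of the cut
     side. *)
  rewrite -cutE -leeBlDr // H2 -EFinB opprD addrA -sum_supply.
  exact: cutU.
(* Every vertex set is a cut side, so no cut condition is missed. *)
have -> : U = cut_side [set s | inl s \in U] [set s | inr s \notin U].
  by rewrite /cut_side; apply/setP => -[s|s]; rewrite !inE ?negbK.
by rewrite sum_supply -addrA -opprD EFinB leeBlDr // -H2 cutE.
Qed.
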